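(* Let $(\mathbb{R}^n,g)$ be a pseudo-Euclidean space, $n\ge 3$, with coordinates $x=(x_1,\dots,x_n)$ and $g_{ij}=\delta_{ij}\varepsilon_i$, $\varepsilon_i=\pm1$. Consider a warped product $M=(\mathbb{R}^n,\overline g)\times_fF^m$ with metric $\widetilde g=\overline g+f^2g_F$, where $\overline g=\frac{1}{\varphi^2}g$, $F$ is an Einstein semi-Riemannian manifold with constant Ricci curvature $\lambda_F$, $m\ge1$, $f,\varphi,h:\mathbb{R}^n\to\mathbb{R}$ are smooth functions and $f$ is positive. Let $r\in\mathbb{N}$, $r\geq 1$. Then $M$ is a quasi-Einstein manifold with $$\mathrm{Ric}_{\widetilde g}-\frac{r}{h}\mathrm{Hess}_{\widetilde g}h=\rho\,\widetilde g,\qquad\rho\in\mathbb{R},$$ if and only if $f$, $\varphi$ and $h$ satisfy the following three families of equations: (1) for all $i\ne j$ in $\{1,\dots,n\}$, $$(n-2)fh\varphi_{,x_ix_j}-rf\varphi h_{,x_ix_j}-mh\varphi f_{,x_ix_j}-mh\varphi_{,x_i}f_{,x_j}-mh\varphi_{,x_j}f_{,x_i}-rf\varphi_{,x_i}h_{,x_j}-rf\varphi_{,x_j}h_{,x_i}=0;$$ (2) for all $i\in\{1,\dots,n\}$, $$\begin{aligned}&\varphi\big[(n-2)fh\varphi_{,x_ix_i}-rf\varphi h_{,x_ix_i}-mh\varphi f_{,x_ix_i}-2mh\varphi_{,x_i}f_{,x_i}-2rf\varphi_{,x_i}h_{,x_i}\big]\\&+\varepsilon_i\sum_{k=1}^n\varepsilon_k\big[fh\varphi\varphi_{,x_kx_k}-(n-1)fh(\varphi_{,x_k})^2+mh\varphi\varphi_{,x_k}f_{,x_k}+rf\varphi\varphi_{,x_k}h_{,x_k}\big]=\varepsilon_i\rho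 fh;\end{aligned}$$ (3) $$\sum_{k=1}^n\varepsilon_k\big[-fh\varphi^2f_{,x_kx_k}+(n-2)fh\varphi\varphi_{,x_k}f_{,x_k}-(m-1)h\varphi^2(f_{,x_k})^2-rf\varphi^2f_{,x_k}h_{,x_k}\big]=h[\rho f^2-\lambda_F].$$
   Context: Subscripts after a comma denote partial derivatives: $f_{,x_i}=\partial f/\partial x_i$, $f_{,x_ix_j}=\partial^2f/\partial x_i\partial x_j$, and similarly for $\varphi,h$. The warped product $(\mathbb{R}^n,\overline g)\times_fF^m$ is $\mathbb{R}^n\times F$ with the metric $\overline g+f^2g_F$. $F$ has dimension $m$ and metric $g_F$, and ''Einstein with constant Ricci curvature $\lambda_F$'' means $\mathrm{Ric}_{g_F}=\lambda_Fg_F$ with $\lambda_F\in\mathbb{R}$ constant. The function $h$ is regarded as a function on $M$ via the projection $M\to\mathbb{R}^n$. The functions $\varphi$ and $h$ are nowhere zero, so that $\overline g$ and $r/h$ make sense. *)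

(* Defs.v *)
From HB Require Import structures.
From mathcomp Require Import all_boot all_order all_algebra.
From mathcomp Require Import all_classical all_reals all_analysis.
Import Order.TTheory GRing.Theory Num.Theory.
Import numFieldNormedType.Exports.

Set Implicit Arguments.
Unset Strict Implicit.
Unset Printing Implicit Defensive.

Local Open Scope classical_set_scope.
Local Open Scope ring_scope.

Definition partial (R : realType) (d : nat) (i : 'I_d) (u : 'rV[R]_d -> R) :
    'rV[R]_d -> R :=
  fun x => 'D_(delta_mx 0 i) u x.

Definition partial2 (R : realType) (d : nat) (i j : 'I_d) (u : 'rV[R]_d -> R) :
    'rV[R]_d -> R :=
  partial j (partial i u).

(* Only meant for open U: the derivatives at a point of U are then determined
   by the restriction of u to U. *)
Fixpoint C_on (R : realType) (d : nat) (k : nat) (U : set 'rV[R]_d)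
    (u : 'rV[R]_d -> R) : Prop :=
  (forall x, U x -> {for x, continuous u}) /\
  match k with
  | 0 => True
  | k'.+1 => forall i : 'I_d,
      (forall x, U x -> derivable u x (delta_mx 0 i)) /\
      C_on k' U (partial i u)
  end.

Definition smooth_on (R : realType) (d : nat) (U : set 'rV[R]_d)
    (u : 'rV[R]_d -> R) : Prop :=
  forall k, C_on k U u.

(* Classical tensor calculus in a coordinate domain, for a metric given by its
   matrix of components G x = (g_ij(x)). *)

(* Gamma^k_ij *)
Definition christoffel (R : realType) (d : nat) (G : 'rV[R]_d -> 'M[R]_d)
    (k i j : 'I_d) : 'rV[R]_d -> R :=
  fun x => 2%:R^-1 * \sum_l invmx (G x) k l *
    (partial i (fun y => G y j l) x + partial j (fun y => G y i l) x
     - partial l (fun y => G y i j) x).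

(* The component R^k_{lij}, i.e. R(d_i, d_j) d_l = sum_k R^k_{lij} d_k, for
   R(X,Y)Z = nabla_X nabla_Y Z - nabla_Y nabla_X Z - nabla_[X,Y] Z. *)
Definition riemann (R : realType) (d : nat) (G : 'rV[R]_d -> 'M[R]_d)
    (k l i j : 'I_d) : 'rV[R]_d -> R :=
  fun x => partial i (christoffel G k j l) x - partial j (christoffel G k i l) x
    + \sum_p (christoffel G k i p x * christoffel G p j l x
              - christoffel G k j p x * christoffel G p i l x).

(* Ric(Y,Z) = trace (X |-> R(X,Y)Z) *)
Definition ricci (R : realType) (d : nat) (G : 'rV[R]_d -> 'M[R]_d)
    (x : 'rV[R]_d) : 'M[R]_d :=
  \matrix_(i, j) \sum_k riemann G k j k i x.

Definition hessian (R : realType) (d : nat) (G : 'rV[R]_d -> 'M[R]_d)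
    (u : 'rV[R]_d -> R) (x : 'rV[R]_d) : 'M[R]_d :=
  \matrix_(i, j) (partial2 i j u x - \sum_k christoffel G k i j x * partial k u x).

Definition neg_def (R : realType) (k : nat) (A : 'M[R]_k) : Prop :=
  forall v : 'rV[R]_k, v != 0 -> (v *m A *m v^T) 0 0 < 0.

(* nu is the largest dimension of a subspace on which A is negative definite;
   the rows of W span such a subspace, and are automatically independent. *)
Definition has_index (R : realType) (d : nat) (A : 'M[R]_d) (nu : nat) : Prop :=
  (exists W : 'M[R]_(nu, d), neg_def (W *m A *m W^T)) /\
  (forall (k : nat) (W : 'M[R]_(k, d)), neg_def (W *m A *m W^T) -> (k <= nu)%N).

(* A space with an atlas and, in each chart, the matrix of components of a
   metric. For a chart a, [coord a] is meaningful on [dom a], while [param a],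
   its inverse, and [gmx a] are meaningful on the image [img a] only. *)
Record metric_atlas (R : realType) (d : nat) := MetricAtlas {
  carrier :> topologicalType;
  chart : Type;
  dom : chart -> set carrier;
  coord : chart -> carrier -> 'rV[R]_d;
  param : chart -> 'rV[R]_d -> carrier;
  gmx : chart -> 'rV[R]_d -> 'M[R]_d }.

Definition img (R : realType) (d : nat) (M : metric_atlas R d) (a : chart M) :
    set 'rV[R]_d :=
  coord a @` dom a.

Definition transition (R : realType) (d : nat) (M : metric_atlas R d)
    (a b : chart M) : 'rV[R]_d -> 'rV[R]_d :=
  fun z => coord b (param a z).

Definition overlap (R : realType) (d : nat) (M : metric_atlas R d)
    (a b : chart M) : set 'rV[R]_d :=
  img a `&` param a @^-1` dom b.

(* Row i is the i-th partial derivative of t. *)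
Definition jac (R : realType) (d : nat) (t : 'rV[R]_d -> 'rV[R]_d)
    (z : 'rV[R]_d) : 'M[R]_d :=
  \matrix_(i, k) partial i (fun y => t y 0 k) z.

Record smooth_atlas (R : realType) (d : nat) (M : metric_atlas R d) : Prop := {
  atlas_nonempty : [set: carrier M] !=set0;
  atlas_hausdorff : hausdorff_space (carrier M);
  atlas_second_countable : @second_countable (carrier M);
  atlas_cover : forall p : M, exists a : chart M, dom a p;
  atlas_dom_open : forall a : chart M, open (dom a);
  atlas_img_open : forall a : chart M, open (img a);
  atlas_coordK : forall (a : chart M) (p : M), dom a p -> param a (coord a p) = p;
  atlas_coord_cont : forall a : chart M, {within dom a, continuous (coord a)};
  atlas_param_cont : forall a : chart M, {within img a, continuous (param a)};
  atlas_transition : forall (a b : chart M) (k : 'I_d),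
    smooth_on (overlap a b) (fun z => transition a b z 0 k) }.

Record metric_tensor (R : realType) (d : nat) (M : metric_atlas R d) : Prop := {
  metric_smooth : forall (a : chart M) (i j : 'I_d),
    smooth_on (img a) (fun z => gmx a z i j);
  metric_sym : forall (a : chart M) (z : 'rV[R]_d), img a z ->
    (gmx a z)^T = gmx a z;
  metric_nondegenerate : forall (a : chart M) (z : 'rV[R]_d), img a z ->
    gmx a z \in unitmx;
  metric_index : exists nu : nat, forall (a : chart M) (z : 'rV[R]_d), img a z ->
    has_index (gmx a z) nu;
  metric_change : forall (a b : chart M) (z : 'rV[R]_d), overlap a b z ->
    gmx a z = jac (transition a b) z *m gmx b (transition a b z)
              *m (jac (transition a b) z)^T }.

Definition semi_riemannian (R : realType) (d : nat) (M : metric_atlas R d) : Prop :=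
  smooth_atlas M /\ metric_tensor M.

(* An equality of tensors is an equality of components in every chart. *)

Definition einstein (R : realType) (d : nat) (M : metric_atlas R d) (lambda : R) :
    Prop :=
  forall (a : chart M) (z : 'rV[R]_d), img a z ->
    ricci (gmx a) z = lambda *: gmx a z.

Definition quasi_einstein (R : realType) (d : nat) (M : metric_atlas R d)
    (h : M -> R) (r : nat) (rho : R) : Prop :=
  forall (a : chart M) (z : 'rV[R]_d), img a z ->
    ricci (gmx a) z
      - (r%:R / h (param a z)) *: hessian (gmx a) (fun y => h (param a y)) z
    = rho *: gmx a z.

(* R^n, with its identity chart and the metric of components G. *)
Definition coordinate_space (R : realType) (n : nat) (G : 'rV[R]_n -> 'M[R]_n) :
    metric_atlas R n :=
  @MetricAtlas R n 'rV[R]_n unit (fun=> setT) (fun=> id) (fun=> id) (fun=> G).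

Definition pseudo_euclidean (R : realType) (n : nat) (eps : 'I_n -> R) : 'M[R]_n :=
  diag_mx (\row_i eps i).

Definition conformal_space (R : realType) (n : nat) (eps : 'I_n -> R)
    (phi : 'rV[R]_n -> R) : metric_atlas R n :=
  coordinate_space (fun x => (phi x ^+ 2)^-1 *: pseudo_euclidean eps).

(* B x F with the product topology, the product atlas and the metric
   g_B + f^2 g_F. *)
Definition warped_product (R : realType) (n m : nat) (B : metric_atlas R n)
    (F : metric_atlas R m) (f : B -> R) : metric_atlas R (n + m) :=
  @MetricAtlas R (n + m) (carrier B * carrier F)%type (chart B * chart F)%type
    (fun c => dom c.1 `*` dom c.2)
    (fun c p => row_mx (coord c.1 p.1) (coord c.2 p.2))
    (fun c z => (param c.1 (lsubmx z), param c.2 (rsubmx z)))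
    (fun c z => block_mx (gmx c.1 (lsubmx z)) 0
                  0 (f (param c.1 (lsubmx z)) ^+ 2 *: gmx c.2 (rsubmx z))).

(* Main.v *)
Require Import Defs.
From HB Require Import structures.
From mathcomp Require Import all_boot all_order all_algebra.
From mathcomp Require Import all_classical all_reals all_analysis.
From mathcomp Require Import ring.
Import Order.TTheory GRing.Theory Num.Theory.
Import numFieldNormedType.Exports.
Local Open Scope classical_set_scope.
Local Open Scope ring_scope.
Set Implicit Arguments.
Unset Strict Implicit.
Unset Printing Implicit Defensive.

(* In product coordinates (x, y) the Christoffel symbols of g_B + f^2 g_F are
   those of g_B, those of g_F, -f (grad f)^k (g_F)_ab, and (f_i / f) delta^c_b.
   Hence Ric is block diagonal, with blocks
     Ric_B - (m / f) Hess_B f   and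
     Ric_F - (f Lap f + (m - 1) |grad f|^2) g_F,
   while Hess h has blocks Hess_B h and f <grad f, grad h> g_F.  For
   g_B = phi^-2 diag(eps) these become explicit: the base block times
   f h phi (off the diagonal) or f h phi^2 (on it) gives (1) and (2), and,
   g_F being nonzero, the fibre block gives (3). *)

(** * Directional derivatives *)

(** The components [gmx b] of the fibre metric are known to be symmetric, invertible and
    differentiable only on the image U of a chart. The formulas for the warped metric are therefore
    stated over U, and they may be differentiated there because U is open. Smoothness is expressed
    by iterated partial derivatives, so the symmetry of second derivatives is derived from it; the
    two terms of the curvature produce them in opposite orders. The metric phi^-2 diag(eps) is
    treated through p_k = phi_k / phi: its Christoffel symbols are linear in p with constant
    coefficients, which turns its Ricci tensor into an identity between finite sums resting on
    eps_i^2 = 1. Thanks to the Einstein condition the fibre block is a function of x alone times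
    g_F. Extracting this function at a given x takes a point of F to place over x, and a nonzero
    entry of g_F there. *)

Lemma is_derive_line (R : realType) (V : normedModType R) (u : V -> R)
    (x v : V) (s : R) :
  derivable u (s *: v + x) v ->
  is_derive s 1 (fun t : R => u (t *: v + x)) ('D_v u (s *: v + x)).
Proof.
move=> du.
have E : (fun t => t^-1 *: (((fun t : R => u (t *: v + x)) \o shift s) (t *: 1)
            - u (s *: v + x)))
       = (fun t => t^-1 *: ((u \o shift (s *: v + x)) (t *: v) - u (s *: v + x))).
  by apply/funext => t; rewrite /= [t *: 1]mulr1 scalerDl addrA.
by split; rewrite /derivable /derive E.
Qed.

(** The mean value theorem is applied twice: along v to the difference of [u] on two parallel
    segments, then along w to ['D_v u]. The left-hand side is symmetric in v and w, which is what
    the interchange of derivatives exploits. *)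
Lemma second_difference (R : realType) (V : normedModType R) (u : V -> R)
    (x v w : V) (t : R) : 0 < t ->
  (forall y, derivable u y v) -> (forall y, derivable ('D_v u) y w) ->
  exists a b, [/\ 0 < a < t, 0 < b < t &
    u (t *: v + (t *: w + x)) - u (t *: v + x) - u (t *: w + x) + u x
    = t ^+ 2 * 'D_w ('D_v u) (b *: w + (a *: v + x))].
Proof.
move=> t0 du ddu.
pose g : R -> R := (fun s => u (s *: v + (t *: w + x))) - (fun s => u (s *: v + x)).
have dg (s : R) : is_derive s 1 g ('D_v u (s *: v + (t *: w + x)) - 'D_v u (s *: v + x)).
  by apply: is_deriveB; exact: is_derive_line.
have [|a ain Ea] := MVT t0 (fun s _ => dg s).
  by apply: derivable_within_continuous => s _; have [] := dg s.
have dk (s : R) : is_derive s 1 (fun s : R => 'D_v u (s *: w + (a *: v + x)))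
    ('D_w ('D_v u) (s *: w + (a *: v + x))).
  exact: is_derive_line.
have [|b bin Eb] := MVT t0 (fun s _ => dk s).
  by apply: derivable_within_continuous => s _; have [] := dk s.
exists a, b; split; [by rewrite in_itv in ain | by rewrite in_itv in bin |].
move: Ea Eb; rewrite /g !fctE !scale0r !add0r !subr0 => Ea Eb.
rewrite [LHS](_ : _ = u (t *: v + (t *: w + x)) - u (t *: v + x)
   - (u (t *: w + x) - u x)); last by rewrite opprB addrAC -!addrA.
by rewrite Ea [a *: v + (t *: w + x)]addrCA Eb; ring.
Qed.

(* Symmetry of second derivatives: both iterated derivatives are limits of the
   same second difference quotient. *)
Lemma derive_swap (R : realType) (V : normedModType R) (u : V -> R) (x v w : V) :
  (forall y, derivable u y v) -> (forall y, derivable u y w) ->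
  (forall y, derivable ('D_v u) y w) -> (forall y, derivable ('D_w u) y v) ->
  {for x, continuous ('D_w ('D_v u))} -> {for x, continuous ('D_v ('D_w u))} ->
  'D_w ('D_v u) x = 'D_v ('D_w u) x.
Proof.
move=> dv dw dvw dwv cvw cwv.
have tri (p q q' e : R) : `|q - p| < e / 2 -> `|q' - p| < e / 2 -> `|q - q'| <= e.
  move=> qp q'p; rewrite [e]splitr -(subrKA p) (le_trans (ler_normD _ _))//.
  by rewrite lerD// ltW// distrC.
apply/eqP; rewrite -subr_eq0 -normr_le0; apply/ler_addgt0Pr => e e0.
rewrite add0r.
have e2 : 0 < e / 2 by rewrite divr_gt0.
have /cvgrPdist_lt/(_ _ e2)/nbhs_normP[d1 /= d10 B1] := cvw.
have /cvgrPdist_lt/(_ _ e2)/nbhs_normP[d2 /= d20 B2] := cwv.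
pose d := Num.min d1 d2.
have d0 : 0 < d by rewrite lt_min d10.
(* With step t = d / K both intermediate points lie within d of x; the summand 1 keeps K positive
   when v = w = 0. *)
pose K := `|v| + `|w| + 1.
have K0 : 0 < K by rewrite ltr_wpDl// addr_ge0.
pose t := d / K.
have t0 : 0 < t by rewrite divr_gt0.
have small v' w' a b : 0 < a < t -> 0 < b < t -> `|v'| + `|w'| + 1 = K ->
    `|x - (b *: w' + (a *: v' + x))| < d.
  move=> /andP[a0 at_] /andP[b0 bt] EK.
  have -> : x - (b *: w' + (a *: v' + x)) = - (b *: w' + a *: v').
    by rewrite addrA [_ + x]addrC opprD addrA subrr add0r.
  rewrite normrN (le_lt_trans (ler_normD _ _))// !normrZ !gtr0_norm//.
  rewrite -[d](divfK (lt0r_neq0 K0)) -/t -EK !mulrDr mulr1.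
  rewrite ltr_pwDr// addrC lerD// ler_wpM2r// ltW//.
have [a [b [ha hb E1]]] := second_difference x t0 dv dvw.
have [a' [b' [ha' hb' E2]]] := second_difference x t0 dw dwv.
have E : 'D_w ('D_v u) (b *: w + (a *: v + x))
       = 'D_v ('D_w u) (b' *: v + (a' *: w + x)).
  apply: (@mulfI _ (t ^+ 2)); first by rewrite expf_neq0// lt0r_neq0.
  apply: etrans (esym E1) (etrans _ E2); rewrite (addrCA (t *: v)); congr (_ + _).
  exact: addrAC.
have {}B1 : `|'D_w ('D_v u) x - 'D_w ('D_v u) (b *: w + (a *: v + x))| < e / 2.
  by apply: B1; apply: lt_le_trans (small v w _ _ ha hb erefl) _; rewrite ge_min lexx.
have {}B2 : `|'D_v ('D_w u) x - 'D_v ('D_w u) (b' *: v + (a' *: w + x))| < e / 2.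
  apply: B2; apply: lt_le_trans (small w v _ _ ha' hb' _) _.
    by rewrite /K [`|w| + _]addrC.
  by rewrite ge_min lexx orbT.
rewrite E in B1; exact: tri B1 B2.
Qed.

Lemma partial2C (R : realType) (d : nat) (i j : 'I_d) (u : 'rV[R]_d -> R) x :
  smooth_on setT u -> partial2 i j u x = partial2 j i u x.
Proof.
move=> /(_ 2)[_ u1].
have H k := (u1 k).2.2.
apply: derive_swap => [y|y|y|y||].
- exact: (u1 i).1.
- exact: (u1 j).1.
- exact: (H i j).1.
- exact: (H j i).1.
- exact: (H i j).2.1.
- exact: (H j i).2.1.
Qed.

(** A directional derivative sees only the restriction to one line, so functions on different spaces
    can be compared. The difference quotients coincide, hence no derivability is assumed. In product
    coordinates a function of one factor is differentiated along the zero vector when the direction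
    lies in the other factor. *)
Lemma eq_derive_line (R : realType) (V V' : normedModType R) (F : V -> R)
    (F' : V' -> R) (z w : V) (z' w' : V') :
  (forall t : R, F (t *: w + z) = F' (t *: w' + z')) -> 'D_w F z = 'D_w' F' z'.
Proof.
move=> E; rewrite /derive.
have E0 : F z = F' z' by have := E 0; rewrite !scale0r !add0r.
suff -> : (fun t => t^-1 *: ((F \o shift z) (t *: w) - F z))
        = (fun t => t^-1 *: ((F' \o shift z') (t *: w') - F' z')) by [].
by apply/funext => t /=; rewrite E0 E.
Qed.

(** * Partial derivatives in product coordinates and on open sets *)

Lemma lsubmx_line (R : realType) (n m : nat) (t : R) (a b : 'rV[R]_(n + m)) :
  lsubmx (t *: a + b) = t *: lsubmx a + lsubmx b.
Proof. exact: linearP. Qed.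

Lemma rsubmx_line (R : realType) (n m : nat) (t : R) (a b : 'rV[R]_(n + m)) :
  rsubmx (t *: a + b) = t *: rsubmx a + rsubmx b.
Proof. exact: linearP. Qed.

Lemma partial_lshiftM (R : realType) (n m : nat) (u : 'rV[R]_n -> R)
    (v : 'rV[R]_m -> R) (i : 'I_n) (z : 'rV[R]_(n + m)) :
  derivable u (lsubmx z) (delta_mx 0 i) ->
  partial (lshift m i) (fun z => u (lsubmx z) * v (rsubmx z)) z
  = partial i u (lsubmx z) * v (rsubmx z).
Proof.
move=> du; rewrite mulrC -(deriveMl _ du); apply: eq_derive_line => t.
rewrite lsubmx_line rsubmx_line delta_mx_lshift row_mxKl row_mxKr scaler0 add0r.
exact: mulrC.
Qed.

Lemma partial_rshiftM (R : realType) (n m : nat) (u : 'rV[R]_n -> R)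
    (v : 'rV[R]_m -> R) (a : 'I_m) (z : 'rV[R]_(n + m)) :
  derivable v (rsubmx z) (delta_mx 0 a) ->
  partial (rshift n a) (fun z => u (lsubmx z) * v (rsubmx z)) z
  = u (lsubmx z) * partial a v (rsubmx z).
Proof.
move=> dv; rewrite -(deriveMl _ dv); apply: eq_derive_line => t.
by rewrite lsubmx_line rsubmx_line delta_mx_rshift row_mxKl row_mxKr scaler0 add0r.
Qed.

Lemma partial_lshift_lsubmx (R : realType) (n m : nat) (u : 'rV[R]_n -> R)
    (i : 'I_n) (z : 'rV[R]_(n + m)) :
  partial (lshift m i) (fun z => u (lsubmx z)) z = partial i u (lsubmx z).
Proof.
by apply: eq_derive_line => t; rewrite lsubmx_line delta_mx_lshift row_mxKl.
Qed.

Lemma partial_rshift_rsubmx (R : realType) (n m : nat) (v : 'rV[R]_m -> R)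
    (a : 'I_m) (z : 'rV[R]_(n + m)) :
  partial (rshift n a) (fun z => v (rsubmx z)) z = partial a v (rsubmx z).
Proof.
by apply: eq_derive_line => t; rewrite rsubmx_line delta_mx_rshift row_mxKr.
Qed.

Lemma partial_rshift_lsubmx (R : realType) (n m : nat) (u : 'rV[R]_n -> R)
    (a : 'I_m) (z : 'rV[R]_(n + m)) :
  partial (rshift n a) (fun z => u (lsubmx z)) z = 0.
Proof.
rewrite -[RHS](derive0 u (lsubmx z)); apply: eq_derive_line => t.
by rewrite lsubmx_line delta_mx_rshift row_mxKl.
Qed.

Lemma partial_lshift_rsubmx (R : realType) (n m : nat) (v : 'rV[R]_m -> R)
    (i : 'I_n) (z : 'rV[R]_(n + m)) :
  partial (lshift m i) (fun z => v (rsubmx z)) z = 0.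
Proof.
rewrite -[RHS](derive0 v (rsubmx z)); apply: eq_derive_line => t.
by rewrite rsubmx_line delta_mx_lshift row_mxKr.
Qed.

Lemma partial_cst (R : realType) (d : nat) (c : R) (i : 'I_d) (x : 'rV[R]_d) :
  partial i (fun=> c) x = 0.
Proof. exact: derive_cst. Qed.

Lemma eq_partial_on (R : realType) (d : nat) (U : set 'rV[R]_d)
    (u v : 'rV[R]_d -> R) (i : 'I_d) (x : 'rV[R]_d) :
  open U -> U x -> (forall y, U y -> u y = v y) -> partial i u x = partial i v x.
Proof.
move=> oU Ux uv; apply: near_eq_derive; near=> y; apply: uv; near: y.
exact: (open_nbhs_nbhs (conj oU Ux)).
Unshelve. all: by end_near. Qed.

Lemma smooth_derivable (R : realType) (d : nat) (U : set 'rV[R]_d)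
    (u : 'rV[R]_d -> R) (i : 'I_d) (x : 'rV[R]_d) :
  smooth_on U u -> U x -> derivable u x (delta_mx 0 i).
Proof. by move=> /(_ 1)[_ /(_ i)[+ _]]; exact. Qed.
Arguments smooth_derivable {R d U u} i x.

Lemma smooth_partial (R : realType) (d : nat) (U : set 'rV[R]_d)
    (u : 'rV[R]_d -> R) (i : 'I_d) :
  smooth_on U u -> smooth_on U (partial i u).
Proof. by move=> us k; have [_ /(_ i)[]] := us k.+1. Qed.
Arguments smooth_partial {R d U u} i.

(** These are the second derivatives of ln |u|, in a quotient form that ignores the sign of u. It
    serves for the symbols f_i / f of the warped metric and for the logarithmic gradient of phi. *)
Lemma partial_log (R : realType) (d : nat) (u : 'rV[R]_d -> R) (i j : 'I_d)
    (x : 'rV[R]_d) :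
  smooth_on setT u -> u x != 0 ->
  partial i (fun x => partial j u x / u x) x
  = partial2 j i u x / u x - partial i u x * partial j u x / u x ^+ 2.
Proof.
move=> us ux; have du := smooth_derivable i x us (I : setT x).
have ddu := smooth_derivable i x (smooth_partial j us) (I : setT x).
have := deriveM ddu (derivableV ux du).
rewrite (deriveV ux du) /GRing.scale /= => E; rewrite [LHS]E /partial2.
by rewrite -!/(partial _ _ _); field.
Qed.

(** * Warped products *)

(** The warped metric in one product chart, detached from any atlas. With [Gb] the conformal metric
    and [gm] equal to [gmx b], it is convertible to the components of [warped_product] in the chart
    [(tt, b)]. *)
Definition warped_metric (R : realType) (n m : nat) (Gb : 'rV[R]_n -> 'M[R]_n)
    (gm : 'rV[R]_m -> 'M[R]_m) (f : 'rV[R]_n -> R) (z : 'rV[R]_(n + m)) :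
    'M[R]_(n + m) :=
  block_mx (Gb (lsubmx z)) 0 0 (f (lsubmx z) ^+ 2 *: gm (rsubmx z)).

Section Warped.
Context (R : realType) (n m : nat) (Gb : 'rV[R]_n -> 'M[R]_n)
  (gm : 'rV[R]_m -> 'M[R]_m) (f : 'rV[R]_n -> R).
Local Notation W := (warped_metric Gb gm f).

Lemma warped_ll (i j : 'I_n) :
  (fun z => W z (lshift m i) (lshift m j)) = (fun z => Gb (lsubmx z) i j).
Proof. by apply/funext => z; rewrite block_mxEul. Qed.

Lemma warped_lr (i : 'I_n) (j : 'I_m) :
  (fun z => W z (lshift m i) (rshift n j)) = (fun=> 0).
Proof. by apply/funext => z; rewrite block_mxEur mxE. Qed.

Lemma warped_rl (i : 'I_m) (j : 'I_n) :
  (fun z => W z (rshift n i) (lshift m j)) = (fun=> 0).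
Proof. by apply/funext => z; rewrite block_mxEdl mxE. Qed.

Lemma warped_rr (i j : 'I_m) :
  (fun z => W z (rshift n i) (rshift n j))
  = (fun z => f (lsubmx z) ^+ 2 * gm (rsubmx z) i j).
Proof. by apply/funext => z; rewrite block_mxEdr mxE. Qed.

Context (U : set 'rV[R]_m) (oU : open U).
Context (Gb_unit : forall x, Gb x \in unitmx) (f_neq0 : forall x, f x != 0)
  (gm_unit : forall y, U y -> gm y \in unitmx)
  (gm_sym : forall y, U y -> (gm y)^T = gm y)
  (f_smooth : smooth_on setT f)
  (gm_derivable : forall y i j k, U y -> derivable (fun y => gm y i j) y (delta_mx 0 k)).

Lemma invmx_warped z : U (rsubmx z) ->
  invmx (W z) = block_mx (invmx (Gb (lsubmx z))) 0 0
                  ((f (lsubmx z) ^- 2) *: invmx (gm (rsubmx z))).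
Proof.
move=> Uz; have fu : f (lsubmx z) ^+ 2 \is a GRing.unit.
  by rewrite unitfE expf_neq0.
have Fu : f (lsubmx z) ^+ 2 *: gm (rsubmx z) \in unitmx.
  by rewrite unitmxZ ?gm_unit.
rewrite /warped_metric invmx_block_diag ?invmxZ//.
by rewrite unitmxE det_ublock unitrM -!unitmxE Gb_unit.
Qed.

Lemma derivable_f x i : derivable f x (delta_mx 0 i).
Proof. exact: (smooth_derivable i x f_smooth I). Qed.

Lemma partial_sqr_f x i : partial i (fun x => f x ^+ 2) x = 2 * f x * partial i f x.
Proof. by have := deriveX 2 (@derivable_f x i) => E; rewrite [LHS]E expr1. Qed.

Lemma derivable_sqr_f x i : derivable (fun x => f x ^+ 2) x (delta_mx 0 i).
Proof. by have := @derivableX _ _ f 2 x _ (@derivable_f x i). Qed.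

Lemma dwarped_lll k i j z :
  partial (lshift m k) (fun z => W z (lshift m i) (lshift m j)) z
  = partial k (fun x => Gb x i j) (lsubmx z).
Proof. by rewrite warped_ll (partial_lshift_lsubmx (fun x => Gb x i j)). Qed.

Lemma dwarped_rll c i j z :
  partial (rshift n c) (fun z => W z (lshift m i) (lshift m j)) z = 0.
Proof. by rewrite warped_ll (partial_rshift_lsubmx (fun x => Gb x i j)). Qed.

Lemma dwarped_lr p i b z :
  partial p (fun z => W z (lshift m i) (rshift n b)) z = 0.
Proof. by rewrite warped_lr partial_cst. Qed.

Lemma dwarped_rl p i b z :
  partial p (fun z => W z (rshift n b) (lshift m i)) z = 0.
Proof. by rewrite warped_rl partial_cst. Qed.

Lemma dwarped_lrr k a b z :
  partial (lshift m k) (fun z => W z (rshift n a) (rshift n b)) z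
  = 2 * f (lsubmx z) * partial k f (lsubmx z) * gm (rsubmx z) a b.
Proof.
rewrite warped_rr (@partial_lshiftM _ _ _ (fun x => f x ^+ 2) (fun y => gm y a b)).
  by rewrite partial_sqr_f.
exact: derivable_sqr_f.
Qed.

Lemma dwarped_rrr c a b z : U (rsubmx z) ->
  partial (rshift n c) (fun z => W z (rshift n a) (rshift n b)) z
  = f (lsubmx z) ^+ 2 * partial c (fun y => gm y a b) (rsubmx z).
Proof.
move=> Uz.
rewrite warped_rr (@partial_rshiftM _ _ _ (fun x => f x ^+ 2) (fun y => gm y a b))//.
exact: gm_derivable.
Qed.

Definition gradient k x := \sum_l invmx (Gb x) k l * partial l f x.

(** * Christoffel symbols of the warped metric *)

Lemma christoffel_lll k i j z : U (rsubmx z) ->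
  christoffel W (lshift m k) (lshift m i) (lshift m j) z
  = christoffel Gb k i j (lsubmx z).
Proof.
move=> Uz; rewrite /christoffel big_split_ord /= [X in _ + X]big1 ?addr0; last first.
  by move=> l _; rewrite invmx_warped// block_mxEur mxE mul0r.
congr (_ * _); apply: eq_bigr => l _; rewrite invmx_warped// block_mxEul.
by rewrite !dwarped_lll.
Qed.

Lemma christoffel_llr k i b z : U (rsubmx z) ->
  christoffel W (lshift m k) (lshift m i) (rshift n b) z = 0.
Proof.
move=> Uz; rewrite /christoffel big_split_ord /= [X in _ + X]big1 ?addr0; last first.
  by move=> l _; rewrite invmx_warped// block_mxEur mxE mul0r.
by rewrite big1 ?mulr0// => l _; rewrite !(dwarped_rl, dwarped_rll, dwarped_lr) subr0 addr0 mulr0.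
Qed.

Lemma christoffel_lrl k b i z : U (rsubmx z) ->
  christoffel W (lshift m k) (rshift n b) (lshift m i) z = 0.
Proof.
move=> Uz; rewrite /christoffel big_split_ord /= [X in _ + X]big1 ?addr0; last first.
  by move=> l _; rewrite invmx_warped// block_mxEur mxE mul0r.
by rewrite big1 ?mulr0// => l _; rewrite !(dwarped_rl, dwarped_rll, dwarped_lr) subr0 addr0 mulr0.
Qed.

(** The mixed entries of the metric vanish, so only the derivative of f^2 g_F in a base direction
    survives, with its minus sign; the factor 1/2 cancels the 2 of 2 f f_l. *)
Lemma christoffel_lrr k a b z : U (rsubmx z) ->
  christoffel W (lshift m k) (rshift n a) (rshift n b) z
  = - (f (lsubmx z) * gradient k (lsubmx z)) * gm (rsubmx z) a b.
Proof.
move=> Uz; rewrite /christoffel big_split_ord /= [X in _ + X]big1 ?addr0; last first.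
  by move=> l _; rewrite invmx_warped// block_mxEur mxE mul0r.
rewrite /gradient [in RHS]mulr_sumr -sumrN mulr_suml mulr_sumr; apply: eq_bigr => l _.
rewrite invmx_warped// block_mxEul !dwarped_rl dwarped_lrr.
by field.
Qed.

Lemma christoffel_rll c i j z : U (rsubmx z) ->
  christoffel W (rshift n c) (lshift m i) (lshift m j) z = 0.
Proof.
move=> Uz; rewrite /christoffel big_split_ord /= [X in X + _]big1 ?add0r; last first.
  by move=> l _; rewrite invmx_warped// block_mxEdl mxE mul0r.
by rewrite big1 ?mulr0// => l _; rewrite !(dwarped_rl, dwarped_rll, dwarped_lr) subr0 addr0 mulr0.
Qed.

Lemma christoffel_rlr c i b z : U (rsubmx z) ->
  christoffel W (rshift n c) (lshift m i) (rshift n b) z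
  = (c == b)%:R * (partial i f (lsubmx z) / f (lsubmx z)).
Proof.
move=> Uz; rewrite /christoffel big_split_ord /= [X in X + _]big1 ?add0r; last first.
  by move=> l _; rewrite invmx_warped// block_mxEdl mxE mul0r.
(* The Kronecker delta is the contraction of g_F with its inverse; written as a matrix product it
   expands to the same sum over l. *)
have <- : (invmx (gm (rsubmx z)) *m gm (rsubmx z)) c b = (c == b)%:R.
  by rewrite mulVmx ?mxE ?gm_unit.
rewrite [X in _ = X * _]mxE mulr_suml mulr_sumr; apply: eq_bigr => l _.
rewrite invmx_warped// block_mxEdr dwarped_lrr !dwarped_lr mxE -[in gm _ l b](gm_sym Uz) [_^T l b]mxE.
by field; exact: f_neq0.
Qed.

Lemma christoffel_rrl c b i z : U (rsubmx z) ->
  christoffel W (rshift n c) (rshift n b) (lshift m i) z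
  = (c == b)%:R * (partial i f (lsubmx z) / f (lsubmx z)).
Proof.
move=> Uz; rewrite -christoffel_rlr// /christoffel; congr (_ * _).
apply: eq_bigr => l _; congr (_ * (_ - _)); first exact: addrC.
by rewrite dwarped_rl dwarped_lr.
Qed.

Lemma christoffel_rrr c a b z : U (rsubmx z) ->
  christoffel W (rshift n c) (rshift n a) (rshift n b) z
  = christoffel gm c a b (rsubmx z).
Proof.
move=> Uz; rewrite /christoffel big_split_ord /= [X in X + _]big1 ?add0r; last first.
  by move=> l _; rewrite invmx_warped// block_mxEdl mxE mul0r.
congr (_ * _); apply: eq_bigr => l _.
rewrite invmx_warped// block_mxEdr mxE !dwarped_rrr//.
by field; exact: f_neq0.
Qed.

Local Notation Z := [set z : 'rV[R]_(n + m) | U (rsubmx z)].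

(** * Ricci tensor of the warped metric *)

Lemma open_preimage_rsubmx : open Z.
Proof.
apply: open_comp => // z _; exact/differentiable_continuous/differentiable_rsubmx.
Qed.

Lemma eq_partial_preimage (F G : 'rV[R]_(n + m) -> R) p z : U (rsubmx z) ->
  (forall z, U (rsubmx z) -> F z = G z) -> partial p F z = partial p G z.
Proof. by move=> Uz FG; apply: (@eq_partial_on _ _ _ _ _ _ _ open_preimage_rsubmx Uz). Qed.

Lemma christoffel_gmC c a b y : U y ->
  christoffel gm c a b y = christoffel gm c b a y.
Proof.
move=> Uy; rewrite /christoffel; congr (_ * _); apply: eq_bigr => l _.
congr (_ * (_ - _)); first exact: addrC.
apply: (@eq_partial_on _ _ _ _ _ _ _ oU Uy) => v /gm_sym gs.
by rewrite -[in LHS]gs mxE.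
Qed.

Lemma ricci_warped_ll i j z : U (rsubmx z) ->
  ricci W z (lshift m i) (lshift m j)
  = ricci Gb (lsubmx z) i j
    - m%:R / f (lsubmx z) * hessian Gb f (lsubmx z) i j.
Proof.
move=> Uz; rewrite !mxE big_split_ord /=; congr (_ + _).
  apply: eq_bigr => k _; rewrite /riemann.
  rewrite (eq_partial_preimage _ Uz (@christoffel_lll k i j)) (partial_lshift_lsubmx (christoffel Gb k i j)).
  rewrite (eq_partial_preimage _ Uz (@christoffel_lll k k j)) (partial_lshift_lsubmx (christoffel Gb k k j)).
  rewrite big_split_ord /= [X in _ + (_ + X)]big1 ?addr0; last first.
    by move=> p _; rewrite !christoffel_llr// !mul0r subr0.
  by congr (_ + _); apply: eq_bigr => p _; rewrite !christoffel_lll.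
(* Each of the m fibre indices contributes -(1/f) Hess f: the quadratic part of the derivative of
   f_j / f cancels against the product of symbols with p = c. *)
rewrite (eq_bigr (fun=> - (f (lsubmx z))^-1 * (partial2 i j f (lsubmx z) -
   \sum_k christoffel Gb k i j (lsubmx z) * partial k f (lsubmx z)))).
  by rewrite sumr_const card_ord -[LHS]mulr_natl; ring.
move=> c _; rewrite /riemann.
rewrite (eq_partial_preimage _ Uz (@christoffel_rll c i j)) partial_cst.
rewrite (eq_partial_preimage _ Uz (@christoffel_rrl c c j)) eqxx !mulr1n.
have -> : (fun z : 'rV[R]_(n + m) => true%:R * (partial j f (lsubmx z) / f (lsubmx z)))
        = (fun z => (fun x => partial j f x / f x) (lsubmx z)).
  by apply/funext => y; rewrite mul1r.
rewrite (partial_lshift_lsubmx (fun x => partial j f x / f x)) partial_log//.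
rewrite big_split_ord /= (bigD1 c)//= [X in _ + (_ + (_ + X))]big1 => [|d dc]; last first.
  rewrite christoffel_rll// mulr0 christoffel_rlr// eq_sym (negbTE dc) !mul0r.
  exact: subrr.
rewrite christoffel_rll// christoffel_rlr// christoffel_rrl// eqxx !mulr1n.
rewrite (eq_bigr (fun p => (f (lsubmx z))^-1 * (christoffel Gb p i j (lsubmx z) *
   partial p f (lsubmx z)))); last first.
  move=> p _; rewrite christoffel_rrl// christoffel_lll// christoffel_rll// eqxx !mulr1n.
  ring.
rewrite -mulr_sumr (partial2C i j)//.
by field; exact: f_neq0.
Qed.

(** Every index of the trace contributes 0. The differentiated symbols either vanish or depend on
    the other factor, and for a fibre index c the two products, both equal to (f_i / f) times the
    fibre symbol with indices c, c, b, cancel. *)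
Lemma ricci_warped_lr i b z : U (rsubmx z) ->
  ricci W z (lshift m i) (rshift n b) = 0.
Proof.
move=> Uz; rewrite mxE big_split_ord /= !big1 ?addr0// => [c _|k _]; rewrite /riemann.
  rewrite (eq_partial_preimage _ Uz (@christoffel_rlr c i b)).
  rewrite (partial_rshift_lsubmx (fun x => (c == b)%:R * (partial i f x / f x))).
  rewrite (eq_partial_preimage _ Uz (@christoffel_rrr c c b)).
  rewrite (partial_lshift_rsubmx (christoffel gm c c b)).
  rewrite big_split_ord /= big1 => [|p _]; last first.
    by rewrite christoffel_llr// christoffel_rll// mulr0 mul0r subr0.
  rewrite sumrB (bigD1 b)//= big1 => [|d db]; last first.
    by rewrite christoffel_rlr// (negbTE db) mul0r mulr0.
  rewrite (bigD1 c)//= [X in _ - (_ + X)]big1 => [|d dc]; last first.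
    by rewrite christoffel_rlr// eq_sym (negbTE dc) !mul0r.
  by rewrite !christoffel_rlr// !christoffel_rrr// !eqxx !mulr1n; ring.
rewrite (eq_partial_preimage _ Uz (@christoffel_llr k i b)) partial_cst.
rewrite (eq_partial_preimage _ Uz (@christoffel_llr k k b)) partial_cst.
rewrite subrr add0r big1// => p _; case: (split_ordP p) => q ->.
  by rewrite !christoffel_llr// !mulr0 subrr.
by rewrite !christoffel_llr// !mul0r subrr.
Qed.

(** The definition of [ricci] is not visibly symmetric, so this block is computed separately. Here
    the two remaining products cancel by the symmetry of the fibre symbols in their lower
    indices. *)
Lemma ricci_warped_rl a j z : U (rsubmx z) ->
  ricci W z (rshift n a) (lshift m j) = 0.
Proof.
move=> Uz; rewrite mxE big_split_ord /= !big1 ?addr0// => [c _|k _]; rewrite /riemann.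
  rewrite (eq_partial_preimage _ Uz (@christoffel_rrl c a j)).
  rewrite (partial_rshift_lsubmx (fun x => (c == a)%:R * (partial j f x / f x))).
  rewrite (eq_partial_preimage _ Uz (@christoffel_rrl c c j)).
  rewrite (partial_rshift_lsubmx (fun x => (c == c)%:R * (partial j f x / f x))).
  rewrite big_split_ord /= big1 => [|p _]; last first.
    by rewrite !christoffel_lrl// !mulr0 subr0.
  rewrite sumrB (bigD1 a)//= big1 => [|d da]; last first.
    by rewrite christoffel_rrl// (negbTE da) mul0r mulr0.
  rewrite (bigD1 c)//= [X in _ - (_ + X)]big1 => [|d dc]; last first.
    by rewrite [X in _ * X]christoffel_rrl// (negbTE dc) mul0r mulr0.
  rewrite !christoffel_rrl// !christoffel_rrr// (christoffel_gmC c a c)//.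
  by rewrite !eqxx !mulr1n; ring.
rewrite (eq_partial_preimage _ Uz (@christoffel_lrl k a j)) partial_cst.
rewrite (eq_partial_preimage _ Uz (@christoffel_lll k k j)).
rewrite (partial_rshift_lsubmx (christoffel Gb k k j)).
rewrite subrr add0r big1// => p _; case: (split_ordP p) => q ->.
  by rewrite !christoffel_lrl// mulr0 mul0r subrr.
by rewrite christoffel_llr// christoffel_rll// mul0r mulr0 subrr.
Qed.

Context (derivable_gradient : forall k x, derivable (gradient k) x (delta_mx 0 k)).

Lemma partial_f_gradient k x :
  partial k (fun x => - (f x * gradient k x)) x
  = - (f x * partial k (gradient k) x + partial k f x * gradient k x).
Proof.
have dM := derivableM (@derivable_f x k) (@derivable_gradient k x).
rewrite [LHS](deriveN dM) (deriveM (@derivable_f x k) (@derivable_gradient k x)).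
by rewrite /GRing.scale /= [gradient k x * _]mulrC.
Qed.

Lemma derivable_f_gradient k x :
  derivable (fun x => - (f x * gradient k x)) x (delta_mx 0 k).
Proof. by have := derivableN (derivableM (@derivable_f x k) (@derivable_gradient k x)). Qed.

(** The divergence of grad f as the trace of its covariant derivative. Keeping the contracted
    Christoffel symbols explicit matches the sums that occur in the Ricci tensor. *)
Definition laplacian x :=
  \sum_k (partial k (gradient k) x + gradient k x * \sum_p christoffel Gb p p k x).

Lemma ricci_warped_rr a b z : U (rsubmx z) ->
  ricci W z (rshift n a) (rshift n b)
  = ricci gm (rsubmx z) a b
    - (f (lsubmx z) * laplacian (lsubmx z)
       + (m%:R - 1) * \sum_k partial k f (lsubmx z) * gradient k (lsubmx z))
      * gm (rsubmx z) a b.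
Proof.
move=> Uz; rewrite mxE big_split_ord /=.
set x := lsubmx z; set y := rsubmx z.
(* For a base index, the term f_k (grad f)^k from differentiating -f (grad f)^k cancels against the
   product of mixed symbols; the sum over k of what remains is -f Lap f times g_F. *)
have El k : riemann W (lshift m k) (rshift n b) (lshift m k) (rshift n a) z
  = - (f x * partial k (gradient k) x) * gm y a b
    - \sum_p christoffel Gb k k p x * (f x * gradient p x * gm y a b).
  rewrite /riemann (eq_partial_preimage _ Uz (@christoffel_lrr k a b)).
  rewrite (@partial_lshiftM _ _ _ (fun x => - (f x * gradient k x)) (fun y => gm y a b)); last first.
    exact: derivable_f_gradient.
  rewrite partial_f_gradient (eq_partial_preimage _ Uz (@christoffel_llr k k b)) partial_cst.
  rewrite big_split_ord /= (bigD1 b)//= [X in _ + (_ + (_ + X))]big1 => [|d db]; last first.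
    by rewrite christoffel_llr// christoffel_rlr// (negbTE db) !mul0r mulr0 subrr.
  rewrite christoffel_llr// christoffel_rlr// eqxx !mulr1n christoffel_lrr// -/x -/y.
  rewrite -sumrN.
  rewrite (eq_bigr (fun p => - (christoffel Gb k k p x * (f x * gradient p x * gm y a b)))); last first.
    move=> p _; rewrite christoffel_lll// christoffel_lrr// christoffel_lrl// -/x -/y.
    ring.
  by field; exact: f_neq0.
(* Each of the m fibre indices subtracts |grad f|^2 g_ab, and c = a adds it back once: this is the
   origin of m - 1. *)
have Er c : riemann W (rshift n c) (rshift n b) (rshift n c) (rshift n a) z
  = riemann gm c b c a y - \sum_p partial p f x * gradient p x * gm y a b
    + (c == a)%:R * \sum_p partial p f x * gradient p x * gm y c b.
  rewrite /riemann (eq_partial_preimage _ Uz (@christoffel_rrr c a b)).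
  rewrite (partial_rshift_rsubmx (christoffel gm c a b)).
  rewrite (eq_partial_preimage _ Uz (@christoffel_rrr c c b)).
  rewrite (partial_rshift_rsubmx (christoffel gm c c b)).
  rewrite big_split_ord /= -!addrA; congr (_ + (_ + _)); rewrite addrC; congr (_ + _).
    by apply: eq_bigr => d _; rewrite !christoffel_rrr.
  rewrite mulr_sumr -sumrN -big_split; apply: eq_bigr => p _ /=.
  rewrite !christoffel_rrl// !christoffel_lrr// eqxx !mulr1n -/x -/y.
  by field; exact: f_neq0.
rewrite (eq_bigr _ (fun k _ => El k)) (eq_bigr _ (fun c _ => Er c)).
rewrite sumrB big_split /= sumrB sumr_const card_ord -[_ *+ m]mulr_natl.
have -> : \sum_(c < m) (c == a)%:R * (\sum_p partial p f x * gradient p x * gm y c b)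
        = (\sum_p partial p f x * gradient p x) * gm y a b.
  rewrite (bigD1 a)//= [X in _ + X]big1 => [|c ca]; last by rewrite (negbTE ca) mul0r.
  by rewrite eqxx mul1r addr0 mulr_suml.
rewrite exchange_big /= /laplacian [in RHS]big_split /= mxE.
rewrite -!mulr_suml.
rewrite [X in _ - X + _](_ : _ = f x * (\sum_k gradient k x * \sum_p christoffel Gb p p k x)
   * gm y a b); last first.
  rewrite mulr_sumr mulr_suml; apply: eq_bigr => p _.
  rewrite -mulr_suml; ring.
rewrite sumrN -mulr_sumr; ring.
Qed.

(** * Hessians of functions lifted from the base *)

Lemma hessian_warped_ll (h : 'rV[R]_n -> R) i j z : U (rsubmx z) ->
  hessian W (fun z => h (lsubmx z)) z (lshift m i) (lshift m j)
  = hessian Gb h (lsubmx z) i j.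
Proof.
move=> Uz; rewrite !mxE /partial2.
have -> : partial (lshift m i) (fun z => h (lsubmx z)) = (fun z => partial i h (lsubmx z)).
  by apply/funext => y; rewrite partial_lshift_lsubmx.
rewrite partial_lshift_lsubmx big_split_ord /= [X in _ - (_ + X)]big1 ?addr0 => [|c _].
  by congr (_ - _); apply: eq_bigr => k _; rewrite christoffel_lll// partial_lshift_lsubmx.
by rewrite partial_rshift_lsubmx mulr0.
Qed.

Lemma hessian_warped_lr (h : 'rV[R]_n -> R) i b z : U (rsubmx z) ->
  hessian W (fun z => h (lsubmx z)) z (lshift m i) (rshift n b) = 0.
Proof.
move=> Uz; rewrite !mxE /partial2.
have -> : partial (lshift m i) (fun z => h (lsubmx z)) = (fun z => partial i h (lsubmx z)).
  by apply/funext => y; rewrite partial_lshift_lsubmx.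
rewrite partial_rshift_lsubmx big_split_ord /= !big1 ?(addr0, subr0)// => [c _|k _].
  by rewrite partial_rshift_lsubmx mulr0.
by rewrite christoffel_llr// mul0r.
Qed.

Lemma hessian_warped_rl (h : 'rV[R]_n -> R) a j z : U (rsubmx z) ->
  hessian W (fun z => h (lsubmx z)) z (rshift n a) (lshift m j) = 0.
Proof.
move=> Uz; rewrite !mxE /partial2.
have -> : partial (rshift n a) (fun z => h (lsubmx z)) = (fun=> 0).
  by apply/funext => y; rewrite partial_rshift_lsubmx.
rewrite partial_cst big_split_ord /= !big1 ?(addr0, subr0)// => [c _|k _].
  by rewrite partial_rshift_lsubmx mulr0.
by rewrite christoffel_lrl// mul0r.
Qed.

Lemma hessian_warped_rr (h : 'rV[R]_n -> R) a b z : U (rsubmx z) ->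
  hessian W (fun z => h (lsubmx z)) z (rshift n a) (rshift n b)
  = f (lsubmx z) * (\sum_k gradient k (lsubmx z) * partial k h (lsubmx z))
    * gm (rsubmx z) a b.
Proof.
move=> Uz; rewrite !mxE /partial2.
have -> : partial (rshift n a) (fun z => h (lsubmx z)) = (fun=> 0).
  by apply/funext => y; rewrite partial_rshift_lsubmx.
rewrite partial_cst big_split_ord /= [X in _ - (_ + X)]big1 ?addr0 => [|c _]; last first.
  by rewrite partial_rshift_lsubmx mulr0.
rewrite sub0r -sumrN mulr_sumr mulr_suml; apply: eq_bigr => k _.
rewrite christoffel_lrr// partial_lshift_lsubmx; ring.
Qed.

End Warped.

(** * Conformally flat metrics *)

Definition conformal_metric (R : realType) (n : nat) (eps : 'I_n -> R)
    (phi : 'rV[R]_n -> R) (x : 'rV[R]_n) : 'M[R]_n :=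
  (phi x ^+ 2)^-1 *: pseudo_euclidean eps.

Lemma sum_delta (R : realType) (n : nat) (i : 'I_n) (u : 'I_n -> R) :
  \sum_k (k == i)%:R * u k = u i.
Proof.
rewrite (bigD1 i)//= eqxx mul1r big1 ?addr0// => k ki.
by rewrite (negbTE ki) mul0r.
Qed.

(** * Algebra of the conformal Christoffel symbols *)

Section ConformalAlgebra.
Context (R : realType) (n : nat) (eps p : 'I_n -> R).
Context (eps2 : forall i, eps i * eps i = 1).

(* With p the gradient of ln phi, these are the Christoffel symbols of the
   metric with components eps_i delta_ij / phi^2. *)
Definition conf_gamma (k i j : 'I_n) : R :=
  (i == j)%:R * (eps i * eps k * p k) - (k == i)%:R * p j - (k == j)%:R * p i.

Lemma conf_gammaC k i j : conf_gamma k i j = conf_gamma k j i.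
Proof.
rewrite /conf_gamma addrAC eq_sym; congr (_ - _ - _).
by case: eqVneq => [->//|_]; rewrite !mul0r.
Qed.

Lemma conf_gamma_contract i j (c : 'I_n -> R) :
  \sum_k conf_gamma k i j * c k
  = (i == j)%:R * eps i * (\sum_k eps k * p k * c k) - c i * p j - c j * p i.
Proof.
under eq_bigr => k _ do rewrite /conf_gamma !mulrBl -!mulrA.
rewrite !sumrB !sum_delta -!mulr_sumr -!mulrA [c i * _]mulrC [c j * _]mulrC.
by under [in RHS]eq_bigr => k _ do rewrite -mulrA.
Qed.

(** This is the usual formula for the contracted symbol, the derivative of ln sqrt |det g|, with
    |det g| = phi^(-2n). *)
Lemma conf_gamma_trace j : \sum_k conf_gamma k k j = - n%:R * p j.
Proof.
under eq_bigr => k _ do rewrite /conf_gamma eqxx mul1r eps2.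
rewrite !sumrB !sum_delta sumr_const card_ord -mulr_natl; ring.
Qed.

Let S := \sum_k eps k * p k ^+ 2.

Let SE : \sum_k eps k * p k * p k = S.
Proof. by apply: eq_bigr => k _; rewrite -mulrA. Qed.

Lemma conf_gamma_grad i k :
  \sum_l eps l * p l * conf_gamma k i l = - ((k == i)%:R * S).
Proof.
rewrite /conf_gamma.
under eq_bigr => l _ do rewrite !mulrBr [_ * (_ * (_ * p k))]mulrCA
  [_ * (_ * p l)]mulrCA [_ * (_ * p i)]mulrCA [k == l]eq_sym [i == l]eq_sym.
rewrite !sumrB !sum_delta -mulr_sumr SE.
transitivity ((eps i * eps i) * p i * (eps k * p k) - (k == i)%:R * S
   - eps k * p k * p i); first by ring.
by rewrite eps2; ring.
Qed.

Lemma conf_gamma_contract2 i j :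
  \sum_k \sum_l conf_gamma k i l * conf_gamma l k j
  = (n%:R + 2) * p i * p j - 2 * (i == j)%:R * eps i * S.
Proof.
under eq_bigr => k _.
  under eq_bigr => l _ do rewrite mulrC.
  rewrite conf_gamma_contract conf_gamma_grad -mulrA conf_gammaC.
over.
rewrite !sumrB sum_delta -mulr_suml conf_gamma_trace conf_gamma_contract SE.
rewrite [j == i]eq_sym.
have -> : eps j * - ((i == j)%:R * S) = - ((i == j)%:R * eps i * S).
  by case: eqVneq => [->|_]; rewrite ?mulr1n ?mulr0n; ring.
ring.
Qed.

(** [P a k] stands for the derivative of p_k in direction a and [dgamma] for the differentiated
    symbols. [P] is an arbitrary matrix here, so both P i j and P j i remain; they merge once P is a
    matrix of second derivatives. *)
Lemma conf_gamma_ricci (P : 'I_n -> 'I_n -> R) i j :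
  let dgamma a k i j := (i == j)%:R * (eps i * eps k * P a k)
    - (k == i)%:R * P a j - (k == j)%:R * P a i in
  \sum_k (dgamma k k i j - dgamma i k k j
    + \sum_l (conf_gamma k k l * conf_gamma l i j
              - conf_gamma k i l * conf_gamma l k j))
  = (n%:R - 1) * P i j - P j i + (n%:R - 2) * (p i * p j)
    + (i == j)%:R * eps i * \sum_k eps k * (P k k - (n%:R - 2) * p k ^+ 2).
Proof.
move=> dgamma; rewrite big_split /= sumrB.
have -> : \sum_k dgamma k k i j = (i == j)%:R * eps i * (\sum_k eps k * P k k) - P i j - P j i.
  rewrite /dgamma !sumrB !sum_delta -mulr_sumr -mulrA [in RHS]mulr_sumr.
  by under eq_bigr => k _ do rewrite -mulrA.
have -> : \sum_k dgamma i k k j = - n%:R * P i j.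
  rewrite /dgamma; under eq_bigr => k _ do rewrite eqxx mul1r eps2.
  by rewrite !sumrB !sum_delta sumr_const card_ord -mulr_natl; ring.
under eq_bigr => k _ do rewrite sumrB.
rewrite sumrB conf_gamma_contract2 exchange_big /=.
under [\sum_l \sum_k _]eq_bigr => l _ do rewrite -mulr_suml conf_gamma_trace mulrC.
rewrite conf_gamma_contract.
under [\sum_k eps k * (_ - _)]eq_bigr => k _ do rewrite mulrBr mulrCA.
rewrite sumrB -mulr_sumr -/S.
have -> : \sum_k eps k * p k * (- n%:R * p k) = - n%:R * S.
  by rewrite -SE mulr_sumr; apply: eq_bigr => k _; ring.
ring.
Qed.
End ConformalAlgebra.

Definition dlog (R : realType) (n : nat) (u : 'rV[R]_n -> R) (k : 'I_n)
    (x : 'rV[R]_n) : R :=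
  partial k u x / u x.

Section Conformal.
Context (R : realType) (n : nat) (eps : 'I_n -> R) (phi : 'rV[R]_n -> R).
Context (eps2 : forall i, eps i * eps i = 1) (phi_smooth : smooth_on setT phi)
  (phi_neq0 : forall x, phi x != 0).
Local Notation G := (conformal_metric eps phi).
Local Notation psi := (dlog phi).

Lemma conformalE i j x : G x i j = (phi x ^+ 2)^-1 * ((i == j)%:R * eps i).
Proof. by rewrite !mxE mulr_natl. Qed.

Lemma conformal_mulV x : G x *m (phi x ^+ 2 *: pseudo_euclidean eps) = 1%:M.
Proof.
rewrite /conformal_metric -scalemxAl -scalemxAr scalerA mulVf ?expf_neq0// scale1r.
apply/matrixP => i j; rewrite mul_diag_mx !mxE.
by case: eqVneq => [->|_]; rewrite ?mulr1n ?mulr0n ?mulr0.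
Qed.

Lemma conformal_unit x : G x \in unitmx.
Proof. by have [] := mulmx1_unit (conformal_mulV x). Qed.

Lemma conformal_invE i j x :
  invmx (G x) i j = (j == i)%:R * (phi x ^+ 2 * eps i).
Proof.
have -> : invmx (G x) = phi x ^+ 2 *: pseudo_euclidean eps.
  by rewrite -[LHS]mulmx1 -(conformal_mulV x) mulKmx// conformal_unit.
by rewrite !mxE -mulr_natl eq_sym; ring.
Qed.

Lemma partial_conformal k i j x :
  partial k (fun x => G x i j) x
  = (i == j)%:R * (- 2 * eps i / phi x ^+ 2 * psi k x).
Proof.
have dphi := smooth_derivable k x phi_smooth (I : setT x).
have dphi2 : derivable (phi ^+ 2) x (delta_mx 0 k) by exact: derivableX.
have phi20 : (phi ^+ 2) x != 0 by rewrite exprfctE expf_neq0.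
have -> : (fun x => G x i j)
        = ((i == j)%:R * eps i) \*o (fun x => ((phi ^+ 2) x)^-1).
  by apply/funext => y /=; rewrite conformalE exprfctE mulrC.
rewrite [LHS]deriveMl; last exact: derivableV.
rewrite deriveV// deriveX// /GRing.scale /= !exprfctE -!/(partial _ _ _) expr1.
by rewrite /dlog; field.
Qed.

Lemma conformal_christoffelE k i j x :
  christoffel G k i j x = conf_gamma eps (psi ^~ x) k i j.
Proof.
rewrite /christoffel.
under eq_bigr => l _ do rewrite conformal_invE -mulrA.
rewrite sum_delta !partial_conformal /conf_gamma.
move: (psi i x) (psi j x) (psi k x) => pi pj pk.
(* Where the delta is nonzero, a may be replaced by k, so that each such term acquires the factor
   eps_k^2 = 1. *)
have E a c : (a == k)%:R * (- 2 * eps a / phi x ^+ 2 * c)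
           = (k == a)%:R * (- 2 * eps k / phi x ^+ 2 * c).
  by rewrite eq_sym; case: eqVneq => [->//|_]; rewrite !mul0r.
rewrite !E; transitivity ((i == j)%:R * (eps i * eps k * pk)
    - (eps k * eps k) * ((k == i)%:R * pj)
    - (eps k * eps k) * ((k == j)%:R * pi)); last by rewrite !eps2 !mul1r.
by field; rewrite phi_neq0.
Qed.

Lemma derivable_dlog a k x : derivable (psi k) x (delta_mx 0 a).
Proof.
have d1 := smooth_derivable a x (smooth_partial k phi_smooth) I.
have d2 := derivableV (phi_neq0 x) (smooth_derivable a x phi_smooth I).
by have := derivableM d1 d2.
Qed.

Lemma partial_dlog a k x :
  partial a (psi k) x = partial2 k a phi x / phi x - psi a x * psi k x.
Proof. by rewrite partial_log// /dlog; field. Qed.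

Lemma partial_conformal_christoffel a k i j x :
  partial a (christoffel G k i j) x
  = (i == j)%:R * (eps i * eps k * partial a (psi k) x)
    - (k == i)%:R * partial a (psi j) x - (k == j)%:R * partial a (psi i) x.
Proof.
move: (@derivable_dlog a k x) (@derivable_dlog a i x) (@derivable_dlog a j x).
have -> : christoffel G k i j = (fun x => conf_gamma eps (psi ^~ x) k i j).
  by apply/funext => y; exact: conformal_christoffelE.
rewrite /conf_gamma; move: (psi k) (psi i) (psi j) => uk ui uj dk di dj.
have -> : (fun x => (i == j)%:R * (eps i * eps k * uk x)
    - (k == i)%:R * uj x - (k == j)%:R * ui x)
  = (((i == j)%:R * (eps i * eps k)) \*o uk)
    - ((k == i)%:R \*o uj) - ((k == j)%:R \*o ui).
  by apply/funext => y; rewrite !fctE /= mulrA.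
have dM c (u : _ -> R) : derivable u x (delta_mx 0 a) ->
    derivable (c \*o u) x (delta_mx 0 a).
  by move=> du; have := derivableM (derivable_cst c x (delta_mx 0 a)) du.
rewrite [LHS](deriveB (derivableB (dM _ _ dk) (dM _ _ dj)) (dM _ _ di)).
rewrite (deriveB (dM _ _ dk) (dM _ _ dj)) !deriveMl//.
by rewrite -!mulrA.
Qed.

(** The products p_i p_j cancel the quadratic part of the second derivatives of ln |phi|, leaving
    phi_ij / phi; in the sum over k the same quadratic part turns n - 2 into n - 1. *)
Lemma conformal_ricci i j x :
  ricci G x i j = (n%:R - 2) * partial2 i j phi x / phi x
    + (i == j)%:R * eps i * \sum_k eps k *
       (partial2 k k phi x / phi x - (n%:R - 1) * psi k x ^+ 2).
Proof.
rewrite mxE /riemann.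
under eq_bigr => k _.
  rewrite !partial_conformal_christoffel.
  under eq_bigr => l _ do rewrite !conformal_christoffelE.
over.
rewrite (conf_gamma_ricci _ eps2 (fun a k => partial a (psi k) x)) /=.
rewrite !partial_dlog (partial2C j i)//.
have -> : \sum_k eps k * (partial k (psi k) x - (n%:R - 2) * psi k x ^+ 2)
  = \sum_k eps k * (partial2 k k phi x / phi x - (n%:R - 1) * psi k x ^+ 2).
  by apply: eq_bigr => k _; rewrite partial_dlog; ring.
ring.
Qed.

Lemma conformal_hessian (u : 'rV[R]_n -> R) i j x :
  hessian G u x i j = partial2 i j u x + partial i u x * psi j x
    + partial j u x * psi i x
    - (i == j)%:R * eps i * \sum_k eps k * psi k x * partial k u x.
Proof.
rewrite mxE; under eq_bigr => k _ do rewrite conformal_christoffelE.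
by rewrite conf_gamma_contract; ring.
Qed.

Context (f : 'rV[R]_n -> R) (f_smooth : smooth_on setT f).

Lemma conformal_gradient k :
  gradient G f k = (fun x => phi x ^+ 2 * (eps k * partial k f x)).
Proof.
apply/funext => x; rewrite /gradient.
under eq_bigr => l _ do rewrite conformal_invE -mulrA -mulrA.
by rewrite sum_delta.
Qed.

Let dphi2 k x : derivable (phi ^+ 2) x (delta_mx 0 k).
Proof. by apply: derivableX; exact: smooth_derivable phi_smooth I. Qed.

Let dpf k x : derivable (partial k f) x (delta_mx 0 k).
Proof. exact: (smooth_derivable k x (smooth_partial k f_smooth) I). Qed.

Let depf k x : derivable (eps k \*o partial k f) x (delta_mx 0 k).
Proof. by have := derivableM (derivable_cst (eps k) x _) (@dpf k x). Qed.

Lemma derivable_conformal_gradient k x : derivable (gradient G f k) x (delta_mx 0 k).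
Proof.
by rewrite conformal_gradient; have := derivableM (@dphi2 k x) (@depf k x).
Qed.

Lemma partial_conformal_gradient k x :
  partial k (gradient G f k) x = eps k * (2 * phi x * partial k phi x * partial k f x
    + phi x ^+ 2 * partial2 k k f x).
Proof.
rewrite conformal_gradient; have := deriveM (@dphi2 k x) (@depf k x).
rewrite deriveMl// deriveX; last exact: (smooth_derivable k x phi_smooth I).
rewrite /GRing.scale /= !fctE => E; rewrite [LHS]E /partial2.
by rewrite -!/(partial _ _ _); ring.
Qed.

(** In n - 2, the 2 comes from differentiating the factor phi^2 of the raised gradient and the n
    from the contracted Christoffel symbol. *)
Lemma conformal_laplacian x :
  laplacian G f x = \sum_k eps k * (phi x ^+ 2 * partial2 k k f x
    - (n%:R - 2) * phi x * partial k phi x * partial k f x).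
Proof.
apply: eq_bigr => k _.
rewrite partial_conformal_gradient.
under eq_bigr => p _ do rewrite conformal_christoffelE.
by rewrite conf_gamma_trace// conformal_gradient /dlog; field.
Qed.

End Conformal.

(** * The quasi-Einstein equation *)

Section BaseEquations.
Context (R : realType) (n m : nat) (eps : 'I_n -> R) (f phi h : 'rV[R]_n -> R).
Context (eps2 : forall i, eps i * eps i = 1).
Context (phi_smooth : smooth_on setT phi) (phi_neq0 : forall x, phi x != 0).
Context (f_smooth : smooth_on setT f) (f_neq0 : forall x, f x != 0)
  (h_neq0 : forall x, h x != 0).
Context (r : nat) (rho : R).
Local Notation G := (conformal_metric eps phi).

Definition base_defect x i j : R :=
  ricci G x i j - m%:R / f x * hessian G f x i j
    - r%:R / h x * hessian G h x i j - rho * G x i j.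

Lemma base_defect_off x i j : i != j ->
  f x * h x * phi x * base_defect x i j
  = (n%:R - 2) * f x * h x * partial2 i j phi x
    - r%:R * f x * phi x * partial2 i j h x
    - m%:R * h x * phi x * partial2 i j f x
    - m%:R * h x * partial i phi x * partial j f x
    - m%:R * h x * partial j phi x * partial i f x
    - r%:R * f x * partial i phi x * partial j h x
    - r%:R * f x * partial j phi x * partial i h x.
Proof.
move=> /negbTE ij.
rewrite /base_defect conformal_ricci// !conformal_hessian// conformalE ij !mulr0n !mul0r /dlog.
move: (partial2 i j phi x) (partial2 i j f x) (partial2 i j h x).
move: (partial i phi x) (partial i f x) (partial i h x).
move: (partial j phi x) (partial j f x) (partial j h x).
move: (f x) (f_neq0 x) (h x) (h_neq0 x) (phi x) (phi_neq0 x).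
move=> fx f0 hx h0 px p0 pj fj hj pi fi hi pij fij hij.
by field; rewrite f0 h0 p0.
Qed.

(** Off the diagonal the logarithmic gradient of phi enters linearly and one factor phi clears it.
    Here its squares and the metric entry eps_i / phi^2 require phi^2. *)
Lemma base_defect_diag x i :
  f x * h x * phi x ^+ 2 * base_defect x i i
  = phi x * ((n%:R - 2) * f x * h x * partial2 i i phi x
             - r%:R * f x * phi x * partial2 i i h x
             - m%:R * h x * phi x * partial2 i i f x
             - 2 * m%:R * h x * partial i phi x * partial i f x
             - 2 * r%:R * f x * partial i phi x * partial i h x)
    + eps i * (\sum_(k < n) eps k *
        (f x * h x * phi x * partial2 k k phi x
         - (n%:R - 1) * f x * h x * partial k phi x ^+ 2
         + m%:R * h x * phi x * partial k phi x * partial k f x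
         + r%:R * f x * phi x * partial k phi x * partial k h x))
    - eps i * rho * f x * h x.
Proof.
have -> : \sum_(k < n) eps k *
        (f x * h x * phi x * partial2 k k phi x
         - (n%:R - 1) * f x * h x * partial k phi x ^+ 2
         + m%:R * h x * phi x * partial k phi x * partial k f x
         + r%:R * f x * phi x * partial k phi x * partial k h x)
  = f x * h x * phi x ^+ 2 * (
      \sum_k eps k * (partial2 k k phi x / phi x - (n%:R - 1) * dlog phi k x ^+ 2)
      + m%:R / f x * (\sum_k eps k * dlog phi k x * partial k f x)
      + r%:R / h x * (\sum_k eps k * dlog phi k x * partial k h x)).
  rewrite !mulr_sumr -!big_split /= mulr_sumr; apply: eq_bigr => k _.
  rewrite /dlog.
  move: (partial2 k k phi x) (partial k phi x) (partial k f x) (partial k h x).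
  move: (f x) (f_neq0 x) (h x) (h_neq0 x) (phi x) (phi_neq0 x).
  move=> fx f0 hx h0 px p0 pkk pk fk hk.
  by field; rewrite f0 h0 p0.
rewrite /base_defect conformal_ricci// !conformal_hessian// conformalE eqxx !mulr1n.
move: (\sum_k _) (\sum_k _) (\sum_k _) => s1 s2 s3; rewrite /dlog.
move: (partial2 i i phi x) (partial2 i i f x) (partial2 i i h x).
move: (partial i phi x) (partial i f x) (partial i h x).
move: (f x) (f_neq0 x) (h x) (h_neq0 x) (phi x) (phi_neq0 x).
move=> fx f0 hx h0 px p0 pi fi hi pii fii hii.
by field; rewrite f0 h0 p0.
Qed.

(** The scalar by which g_F is multiplied in the fibre block of Ric - (r/h) Hess h - rho g, once
    Ric_F is replaced by lambda g_F. *)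
Definition fibre_defect (lambda : R) x : R :=
  lambda - (f x * laplacian G f x + (m%:R - 1) * \sum_k partial k f x * gradient G f k x)
    - r%:R / h x * (f x * \sum_k gradient G f k x * partial k h x) - rho * f x ^+ 2.

Lemma fibre_defectE lambda x :
  h x * fibre_defect lambda x
  = \sum_(k < n) eps k *
      (- (f x * h x * phi x ^+ 2 * partial2 k k f x)
       + (n%:R - 2) * f x * h x * phi x * partial k phi x * partial k f x
       - (m%:R - 1) * h x * phi x ^+ 2 * partial k f x ^+ 2
       - r%:R * f x * phi x ^+ 2 * partial k f x * partial k h x)
    - h x * (rho * f x ^+ 2 - lambda).
Proof.
have -> : \sum_(k < n) eps k *
      (- (f x * h x * phi x ^+ 2 * partial2 k k f x)
       + (n%:R - 2) * f x * h x * phi x * partial k phi x * partial k f x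
       - (m%:R - 1) * h x * phi x ^+ 2 * partial k f x ^+ 2
       - r%:R * f x * phi x ^+ 2 * partial k f x * partial k h x)
  = - (h x * (f x * laplacian G f x)
       + h x * ((m%:R - 1) * (\sum_k partial k f x * gradient G f k x))
       + r%:R * (f x * \sum_k gradient G f k x * partial k h x)).
  rewrite conformal_laplacian// !mulr_sumr -!big_split -sumrN /=; apply: eq_bigr => k _.
  rewrite conformal_gradient//.
  move: (partial2 k k f x) (partial k phi x) (partial k f x) (partial k h x).
  by move: (f x) (h x) (phi x) => fx hx px fkk pk fk hk; ring.
rewrite /fibre_defect; move: (laplacian _ _ _) (\sum_k _) (\sum_k _) => s1 s2 s3.
move: (h x) (h_neq0 x) (f x) => hx h0 fx; by field.
Qed.

End BaseEquations.

(** * From the tensor equation in charts to the three families *)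

Lemma img_warped (R : realType) (n m : nat) (eps : 'I_n -> R)
    (phi f : 'rV[R]_n -> R) (F : metric_atlas R m) (b : chart F)
    (z : 'rV[R]_(n + m)) :
  @img _ _ (warped_product (B := conformal_space eps phi) F f) (tt, b) z
  <-> img b (rsubmx z).
Proof.
split=> [[[x p] /= [_ bp] <-]|[p bp E]]; first by exists p; rewrite ?row_mxKr.
by exists (lsubmx z, p) => //=; rewrite E hsubmxK.
Qed.

Theorem theorem2p2 (R : realType) (n m : nat) (hn : (3 <= n)%N) (hm : (1 <= m)%N)
    (eps : 'I_n -> R) (heps : forall i, eps i = 1 \/ eps i = -1)
    (F : metric_atlas R m) (hF : semi_riemannian F)
    (lambdaF : R) (hE : einstein F lambdaF)
    (f phi h : 'rV[R]_n -> R)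
    (f_smooth : smooth_on setT f) (phi_smooth : smooth_on setT phi)
    (h_smooth : smooth_on setT h)
    (f_pos : forall x, 0 < f x) (phi_neq0 : forall x, phi x != 0)
    (h_neq0 : forall x, h x != 0)
    (r : nat) (hr : (1 <= r)%N) (rho : R) :
  quasi_einstein (M := warped_product (B := conformal_space eps phi) F f)
    (fun p => h p.1) r rho
  <->
  [/\ (forall (x : 'rV[R]_n) (i j : 'I_n), i != j ->
        (n%:R - 2) * f x * h x * partial2 i j phi x
        - r%:R * f x * phi x * partial2 i j h x
        - m%:R * h x * phi x * partial2 i j f x
        - m%:R * h x * partial i phi x * partial j f x
        - m%:R * h x * partial j phi x * partial i f x
        - r%:R * f x * partial i phi x * partial j h x
        - r%:R * f x * partial j phi x * partial i h x = 0),
      (forall (x : 'rV[R]_n) (i : 'I_n),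
        phi x * ((n%:R - 2) * f x * h x * partial2 i i phi x
                 - r%:R * f x * phi x * partial2 i i h x
                 - m%:R * h x * phi x * partial2 i i f x
                 - 2 * m%:R * h x * partial i phi x * partial i f x
                 - 2 * r%:R * f x * partial i phi x * partial i h x)
        + eps i * (\sum_(k < n) eps k *
            (f x * h x * phi x * partial2 k k phi x
             - (n%:R - 1) * f x * h x * partial k phi x ^+ 2
             + m%:R * h x * phi x * partial k phi x * partial k f x
             + r%:R * f x * phi x * partial k phi x * partial k h x))
        = eps i * rho * f x * h x)
    & (forall x : 'rV[R]_n,
        \sum_(k < n) eps k *
          (- (f x * h x * phi x ^+ 2 * partial2 k k f x)
           + (n%:R - 2) * f x * h x * phi x * partial k phi x * partial k f x
           - (m%:R - 1) * h x * phi x ^+ 2 * partial k f x ^+ 2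
           - r%:R * f x * phi x ^+ 2 * partial k f x * partial k h x)
        = h x * (rho * f x ^+ 2 - lambdaF))].
Proof.
have eps2 i : eps i * eps i = 1 by case: (heps i) => ->; rewrite ?mulrNN mulr1.
have f_neq0 x : f x != 0 by rewrite gt_eqF.
have [atl met] := hF.
pose G := conformal_metric eps phi.
have Gu x : G x \in unitmx := conformal_unit eps2 phi_neq0 x.
have wd k x : derivable (gradient G f k) x (delta_mx 0 k).
  exact: derivable_conformal_gradient.
have gu (b : chart F) y : img b y -> gmx b y \in unitmx := @metric_nondegenerate _ _ _ met b y.
have gs (b : chart F) y : img b y -> (gmx b y)^T = gmx b y := @Defs.metric_sym _ _ _ met b y.
have gd (b : chart F) y i j k : img b y -> derivable (fun y => gmx b y i j) y (delta_mx 0 k).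
  exact: (smooth_derivable k y (metric_smooth met b i j)).
pose D := base_defect m eps f phi h r rho.
pose E := fibre_defect m eps f phi h r rho lambdaF.
have pointwise (b : chart F) (z : 'rV[R]_(n + m)) : img b (rsubmx z) ->
    (ricci (warped_metric G (gmx b) f) z
      - (r%:R / h (lsubmx z)) *: hessian (warped_metric G (gmx b) f)
          (fun y => h (lsubmx y)) z
     = rho *: warped_metric G (gmx b) f z)
    <-> (forall i j, D (lsubmx z) i j = 0) /\
        (forall a c, E (lsubmx z) * gmx b (rsubmx z) a c = 0).
  move=> bz; have oU := @atlas_img_open _ _ _ atl b.
  have [gub gsb gdb] := And3 (gu b) (gs b) (@gd b).
  have ll i j : ricci (warped_metric G (gmx b) f) z (lshift m i) (lshift m j)
      - r%:R / h (lsubmx z) * hessian (warped_metric G (gmx b) f)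
          (fun y => h (lsubmx y)) z (lshift m i) (lshift m j)
      - rho * warped_metric G (gmx b) f z (lshift m i) (lshift m j)
      = D (lsubmx z) i j.
    rewrite (ricci_warped_ll oU Gu f_neq0 gub gsb f_smooth)//.
    rewrite (hessian_warped_ll Gu f_neq0 gub)//.
    by rewrite block_mxEul.
  have rr a c : ricci (warped_metric G (gmx b) f) z (rshift n a) (rshift n c)
      - r%:R / h (lsubmx z) * hessian (warped_metric G (gmx b) f)
          (fun y => h (lsubmx y)) z (rshift n a) (rshift n c)
      - rho * warped_metric G (gmx b) f z (rshift n a) (rshift n c)
      = E (lsubmx z) * gmx b (rsubmx z) a c.
    rewrite (ricci_warped_rr oU Gu f_neq0 gub gsb f_smooth gdb wd)//.
    rewrite (hessian_warped_rr Gu f_neq0 gub f_smooth)//.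
    rewrite block_mxEdr (hE _ _ bz) !mxE /E /fibre_defect -/G; ring.
  have lr i c : ricci (warped_metric G (gmx b) f) z (lshift m i) (rshift n c) = 0.
    exact: (ricci_warped_lr oU Gu f_neq0 gub gsb f_smooth gdb).
  have rl a j : ricci (warped_metric G (gmx b) f) z (rshift n a) (lshift m j) = 0.
    exact: (ricci_warped_rl oU Gu f_neq0 gub gsb f_smooth gdb).
  have hlr i c : hessian (warped_metric G (gmx b) f) (fun y => h (lsubmx y)) z
      (lshift m i) (rshift n c) = 0.
    exact: (hessian_warped_lr Gu f_neq0 gub).
  have hrl a j : hessian (warped_metric G (gmx b) f) (fun y => h (lsubmx y)) z
      (rshift n a) (lshift m j) = 0.
    exact: (hessian_warped_rl Gu f_neq0 gub).
  have wlr i c : warped_metric G (gmx b) f z (lshift m i) (rshift n c) = 0.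
    by rewrite block_mxEur mxE.
  have wrl a j : warped_metric G (gmx b) f z (rshift n a) (lshift m j) = 0.
    by rewrite block_mxEdl mxE.
  move: ll rr lr rl hlr hrl wlr wrl.
  move: (ricci _ z) (hessian _ _ z) (warped_metric _ _ _ z) => Ric Hess W.
  move=> ll rr lr rl hlr hrl wlr wrl.
  have entry p q : (Ric - (r%:R / h (lsubmx z)) *: Hess - rho *: W) p q
      = Ric p q - r%:R / h (lsubmx z) * Hess p q - rho * W p q by rewrite !mxE.
  split=> [eq|[D0 E0]].
    by split=> [i j|a c]; rewrite -(ll, rr) -entry eq subrr mxE.
  apply: subr0_eq; apply/matrixP => p q; rewrite entry [RHS]mxE.
  case: (split_ordP p) => i ->; case: (split_ordP q) => j ->.
  - by rewrite ll D0.
  - by rewrite lr hlr wlr !mulr0 !subr0.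
  - by rewrite rl hrl wrl !mulr0 !subr0.
  - by rewrite rr E0.
have offE := @base_defect_off _ _ m _ _ _ _ eps2 phi_smooth phi_neq0 f_neq0 h_neq0 r rho.
have diagE := @base_defect_diag _ _ m _ _ _ _ eps2 phi_smooth phi_neq0 f_neq0 h_neq0 r rho.
have fibE := @fibre_defectE _ _ m _ _ _ _ eps2 phi_smooth phi_neq0 f_smooth h_neq0 r rho lambdaF.
rewrite -/D in offE diagE; rewrite -/E in fibE.
have fhphi x : f x * h x * phi x != 0 by rewrite !mulf_neq0.
have fhphi2 x : f x * h x * phi x ^+ 2 != 0 by rewrite !mulf_neq0 ?expf_neq0.
(* The intermediate condition mentions neither charts nor points of F. *)
transitivity (forall x, (forall i j, D x i j = 0) /\ E x = 0).
  split=> [qe x|eqs [[] b] z].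
    (* Some point of F, in some chart, is placed over the given x. *)
    have [p _] := atlas_nonempty atl; have [b bp] := atlas_cover atl p.
    have by0 : img b (Defs.coord b p) by exists p.
    pose z : 'rV[R]_(n + m) := row_mx x (Defs.coord b p).
    have bz : img b (rsubmx z) by rewrite row_mxKr.
    have := qe (tt, b) z (proj2 (@img_warped _ _ _ eps phi f F b z) bz).
    move=> /(proj1 (pointwise b z bz)); rewrite row_mxKl row_mxKr => -[D0 E0]; split=> //.
    apply/eqP; apply: contraT => Ex0.
    (* If the scalar were nonzero, g_F would vanish at this point, against nondegeneracy: as m >= 1,
       the identity matrix has a diagonal entry 1. *)
    have g0 : gmx b (Defs.coord b p) = 0.
      apply/matrixP => a c; rewrite mxE; apply/eqP.
      by move/eqP: (E0 a c); rewrite mulf_eq0 (negbTE Ex0).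
    have := mulmxV (gu _ _ by0); rewrite g0 mul0mx.
    move=> /matrixP/(_ (Ordinal hm) (Ordinal hm)); rewrite !mxE eqxx.
    by move=> /esym/eqP; rewrite oner_eq0.
  move=> /img_warped bz; apply: (proj2 (pointwise b z bz)); have [D0 E0] := eqs (lsubmx z).
  by split=> // a c; rewrite E0 mul0r.
split=> [eqs|[eq1 eq2 eq3] x].
  split=> [x i j ij|x i|x].
  - by rewrite -offE// (eqs x).1 mulr0.
  - apply/eqP; rewrite -subr_eq0; apply/eqP.
    by rewrite -diagE (eqs x).1 mulr0.
  - apply/eqP; rewrite -subr_eq0; apply/eqP.
    by rewrite -fibE (eqs x).2 mulr0.
split=> [i j|].
  have [->|ij] := eqVneq i j.
    apply: (mulfI (fhphi2 x)); rewrite mulr0 diagE.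
    by rewrite eq2 subrr.
  by apply: (mulfI (fhphi x)); rewrite mulr0 offE// eq1.
by apply: (mulfI (h_neq0 x)); rewrite mulr0 fibE eq3 subrr.
Qed.
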